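(* Let $m\ge2$, let $\{\xi_{j}\}_{j=0}^{m-2}$ be distinct points in the open interval $(0,1)$, and let $z_{m,0}=0$. For $n\ge1$ let $y_{m,n}\in{}^{\theta}W_{\rho}^{m}[0,1]$ be the $n$-th iterate of the scheme $$Ly_{m,n}(\xi)=g(\xi,z_{m,n-1}(\xi),z_{m,n-1}'(\xi)),\qquad z_{m,n}(\xi)=P_{m-1}y_{m,n}(\xi),$$ where $P_{m-1}:{}^{\theta}W_{\rho}^{m}[0,1]\to\mathrm{span}\{\bar\psi_0^m,\bar\psi_1^m,\ldots,\bar\psi_{m-2}^m\}$ is the orthogonal projection. Then $$y_{m,n}(\xi)=\sum_{j=0}^{m-2}\sum_{k=0}^{j}\beta_{jk}^{m}\,g(\xi_{k},z_{m,n-1}(\xi_{k}),z_{m,n-1}'(\xi_{k}))\,\bar{\psi}_{j}^{m}(\xi).$$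
   Context: Fix $0<\theta<1$, $1<\alpha\le 2$, $0<\beta\le 1$, sufficiently smooth functions $a_0,a_1,a_2\in C^2(0,1)$, and a sufficiently smooth real function $g(\xi,u,v)$ giving right-hand sides in $L^2_\rho[0,1]$. ${}^{\theta}W_{\rho}^{m}[0,1]$ is the space of real polynomials $z$ of degree at most $m$ on $[0,1]$ with $z(0)=z(\theta)=z(1)=0$, with inner product $\langle z,v\rangle_{{}^{\theta}W_{\rho}^{m}}=\int_0^1 z(\xi)v(\xi)\,d\xi$ (weight $\rho=1$), and $L_\rho^2[0,1]$ is the usual $L^2[0,1]$. ${}^{\theta}R_x^m(\xi)$ is the reproducing kernel of ${}^{\theta}W_{\rho}^{m}[0,1]$: ${}^{\theta}R_x^m\in{}^{\theta}W_{\rho}^{m}[0,1]$ and $\langle z,{}^{\theta}R_x^m\rangle_{{}^{\theta}W_{\rho}^{m}}=z(x)$ for all $z\in{}^{\theta}W_{\rho}^{m}[0,1]$, $x\in[0,1]$. The Caputo derivative of order $\gamma$ with $k-1<\gamma<k$, $k\in\mathbb{N}$, is ${}^{c}D^{\gamma}z(\xi)=\frac{1}{\Gamma(k-\gamma)}\int_0^\xi(\xi-s)^{k-\gamma-1}z^{(k)}(s)\,ds$, and ${}^cD^{k}z=z^{(k)}$ for integer order. The operator $L:{}^{\theta}W_{\rho}^{m}[0,1]\to L_\rho^2[0,1]$, $Lz(\xi)=a_2(\xi)\,{}^{c}D^{\alpha}z(\xi)+a_1(\xi)\,{}^{c}D^{\beta}z(\xi)+a_0(\xi)z(\xi)$,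 is taken to be a bounded linear operator. The functions $\psi_j^m\in{}^{\theta}W_{\rho}^{m}[0,1]$ are $\psi_j^m(\xi)=L_x\,{}^{\theta}R_x^m(\xi)|_{x=\xi_j}$ ($L_x$: $L$ acting in the variable $x$), which the paper also writes as $L^{\ast}\,{}^{\theta}R_{\xi_j}^m(\xi)$. $\{\bar\psi_j^m\}_{j=0}^{m-2}$ is the orthonormal system of ${}^{\theta}W_{\rho}^{m}[0,1]$ derived from $\{\psi_j^m\}_{j=0}^{m-2}$ by Gram-Schmidt orthogonalization, $\bar\psi_j^m(\xi)=\sum_{k=0}^{j}\beta_{jk}^m\psi_k^m(\xi)$, with orthogonalization coefficients $\beta_{jk}^m$; it is taken to be a complete orthonormal system in ${}^{\theta}W_{\rho}^{m}[0,1]$.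
   Formalization: The space of polynomials of degree at most m vanishing at 0, θ, 1 has dimension m−2, so the m−1 functions ψ̄_j cannot all be orthonormal; Gram–Schmidt is allowed to give zero vectors, and only the nonzero ψ̄_j are required to be orthonormal (the system is still complete). *)

(* Defs.v *)
From HB Require Import structures.
From mathcomp Require Import all_boot all_order all_algebra.
From mathcomp Require Import all_classical all_reals all_analysis.
Set Implicit Arguments.
Unset Strict Implicit.
Unset Printing Implicit Defensive.
Import Order.TTheory GRing.Theory Num.Theory.
Import numFieldNormedType.Exports.
Local Open Scope classical_set_scope.
Local Open Scope ring_scope.

Definition Gamma (R : realType) (x : R) : R :=
  \int[lebesgue_measure]_(t in `]0, +oo[%classic) (t `^ (x - 1) * expR (- t)).

(* For non-integer [gamma > 0], the ceiling is the [k] with [k - 1 < gamma < k].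
   The library's convention [0 `^ a = 0] for [a != 0] only affects the integrand
   at the endpoint [s = x], hence not the integral. *)
Definition caputo (R : realType) (gamma : R) (f : R -> R) (x : R) : R :=
  let k := `|Num.ceil gamma|%N in
  if gamma == k%:R then derive1n k f x
  else (Gamma (k%:R - gamma))^-1 *
       \int[lebesgue_measure]_(s in `[0, x]%classic)
         ((x - s) `^ (k%:R - gamma - 1) * derive1n k f s).

Definition diffop (R : realType) (alpha beta : R) (a0 a1 a2 : R -> R)
    (f : R -> R) (x : R) : R :=
  a2 x * caputo alpha f x + a1 x * caputo beta f x + a0 x * f x.

Definition C2_open01 (R : realType) (a : R -> R) : Prop :=
  forall x : R, 0 < x < 1 ->
    [/\ derivable a x 1, derivable (derive1n 1 a) x 1 &
        {for x, continuous (derive1n 2 a)}].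

Definition spaceW (R : realType) (theta : R) (m : nat) : set {poly R} :=
  [set z : {poly R} | [/\ (size z <= m.+1)%N, z.[0] = 0, z.[theta] = 0 & z.[1] = 0]].

Definition ip (R : realType) (z v : {poly R}) : R :=
  \int[lebesgue_measure]_(x in `[0, 1]%classic) (z.[x] * v.[x]).

Definition normW (R : realType) (z : {poly R}) : R := Num.sqrt (ip z z).

(* The restriction [f \_ A] vanishes outside [A], so these are the membership
   and the norm of L^2[0,1]. *)
Definition L2mem (R : realType) (f : R -> R) : Prop :=
  (f \_ `[0, 1]%classic) \in Lfun (@lebesgue_measure R) 2%:E.

Definition L2norm (R : realType) (f : R -> R) : \bar R :=
  Lnorm (@lebesgue_measure R) 2%:E (EFin \o (f \_ `[0, 1]%classic)).

(* Linearity is an equality in L^2[0,1], hence almost everywhere. *)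
Definition bounded_linear_L2 (R : realType) (V : set {poly R})
    (T : {poly R} -> R -> R) : Prop :=
  [/\ forall z, V z -> L2mem (T z),
      forall (c : R) z v, V z -> V v ->
        {ae @lebesgue_measure R, forall x, `[0, 1]%classic x ->
           T (c *: z + v) x = c * T z x + T v x} &
      exists C : R, forall z, V z -> (L2norm (T z) <= (C * normW z)%:E)%E].

Definition reproducing_kernel (R : realType) (V : set {poly R})
    (K : R -> {poly R}) : Prop :=
  forall x : R, 0 <= x <= 1 ->
    V (K x) /\ (forall z, V z -> ip z (K x) = z.[x]).

(* Gram-Schmidt with normalization for the first [N] vectors.  Since
   [0^-1 = 0], a vector whose residual vanishes produces the zero vector. *)
Definition gram_schmidt (R : realType) (N : nat) (psi psibar : nat -> {poly R})
    (b : nat -> nat -> R) : Prop :=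
  forall j, (j < N)%N ->
    let r := psi j - \sum_(i < j) ip (psi j) (psibar i) *: psibar i in
    psibar j = (normW r)^-1 *: r /\
    psibar j = \sum_(k < j.+1) b j k *: psi k.

(* Zero members of the family are discarded.  This matters because three
   boundary conditions on polynomials of degree at most [m] leave a space of
   dimension [m - 2], so that among the [m - 1] vectors produced by
   Gram-Schmidt at least one has a vanishing residual: requiring all [m - 1] of
   them to have norm 1 would be contradictory. *)
Definition complete_orthonormal (R : realType) (V : set {poly R}) (N : nat)
    (e : nat -> {poly R}) : Prop :=
  [/\ forall j, (j < N)%N -> V (e j),
      forall i j, (i < N)%N -> (j < N)%N -> e i != 0 -> e j != 0 ->
        ip (e i) (e j) = (i == j)%:R &
      forall z, V z -> (forall j, (j < N)%N -> ip z (e j) = 0) -> z = 0].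

Definition span_of (R : realType) (N : nat) (e : nat -> {poly R}) :
    set {poly R} :=
  [set z : {poly R} | exists c : nat -> R, z = \sum_(j < N) c j *: e j].

Definition orthogonal_projection (R : realType) (V S : set {poly R})
    (P : {poly R} -> {poly R}) : Prop :=
  forall z, V z -> S (P z) /\ (forall s, S s -> ip (z - P z) s = 0).

(* The scheme carried out up to step [n]. *)
Definition scheme (R : realType) (V : set {poly R}) (L : (R -> R) -> R -> R)
    (g : R -> R -> R -> R) (P : {poly R} -> {poly R}) (n : nat)
    (y z : nat -> {poly R}) : Prop :=
  z 0%N = 0 /\
  forall i, (1 <= i <= n)%N ->
    [/\ V (y i),
        forall x : R, 0 < x < 1 ->
          L (horner (y i)) x = g x (z i.-1).[x] (z i.-1)^`().[x] &
        z i = P (y i)].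

(* Main.v *)
(* Evaluation of [L] at a node is a genuine (not only almost everywhere) linear
   functional on polynomials, because the weight [(x - s)^(k - gamma - 1)] of the
   Caputo integral is integrable.  By symmetry of the kernel, [psi_j] therefore
   represents the functional [z |-> L z (xi_j)] in the inner product.  Expanding
   [y_n] in the system [psibar], writing each [psibar_j] in terms of the [psi_k]
   and replacing [<y_n, psi_k>] by [L y_n (xi_k)] gives the formula. *)
Require Import Defs.
From mathcomp Require Import all_boot all_order all_algebra.
From mathcomp Require Import all_classical all_reals all_analysis.
From mathcomp Require Import measurable_realfun ring.
Import Order.TTheory GRing.Theory Num.Theory.
Import numFieldNormedType.Exports.
Local Open Scope classical_set_scope.
Local Open Scope ring_scope.

(** * Integrability of the singular Caputo weight *)

Lemma is_derive_powR_reflect {R : realType} {x} (c : R) {s : R} : s < x ->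
  is_derive s 1 (fun t => (x - t) `^ c) (- (c * (x - s) `^ (c - 1))).
Proof.
move=> sx; have D := is_derive1_powR c (_ : 0 < x - s).
have Dx : is_derive s 1 (fun t : R => x - t) (-1).
  by apply: is_derive_eq; rewrite add0r mul1r.
rewrite subr_gt0 in D.
have /is_derive_eq := @is_derive1_comp _ _ (fun t : R => x - t) s _ _ (D sx) Dx.
by apply; rewrite mulrN1.
Qed.

Lemma integral_powR_reflect {R : realType} {x a r : R} : -1 < a -> 0 < r < x ->
  (\int[lebesgue_measure]_(s in `[0%R, r]) ((x - s) `^ a)%:E)%E =
  ((x `^ (a + 1) - (x - r) `^ (a + 1)) / (a + 1))%:E.
Proof.
move=> a1 /andP[r0 rx].
have a1' : a + 1 != 0 by rewrite gt_eqF// -ltrBlDr sub0r.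
pose F s := - (a + 1)^-1 * (x - s) `^ (a + 1).
have dF s : s < x -> is_derive s 1 F ((x - s) `^ a).
  move=> sx.
  have := is_deriveZ (- (a + 1)^-1) (is_derive_powR_reflect (a + 1) sx).
  by move=> /is_derive_eq; apply; rewrite addrK /GRing.scale/=; field.
have cF s : s < x -> {for s, continuous F}.
  by move=> /dF[dFs _]; apply/differentiable_continuous/derivable1_diffP.
rewrite (@continuous_FTC2 _ _ F)//; first last.
- move=> s; rewrite in_itv/= => /andP[_ sr].
  by rewrite derive1E; have [_ ->] := dF s (lt_trans sr rx).
- split.
  + by move=> s; rewrite in_itv/= => /andP[_ sr]; have [] := dF s (lt_trans sr rx).
  + by apply: cvg_at_right_filter; apply: cF; exact: lt_trans rx.
  + by apply: cvg_at_left_filter; exact: cF.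
- apply: derivable_within_continuous => s; rewrite in_itv/= => /andP[_ sr].
  by have [] := is_derive_powR_reflect a (le_lt_trans sr rx).
by rewrite /F subr0 -EFinB; congr (_%:E); field.
Qed.

(** The weight is nonnegative, so monotone convergence along compact intervals exhausting [[0, x[]
    applies; [a + 1 > 0] makes the truncated integrals uniformly bounded. *)
Lemma integrable_powR_reflect {R : realType} {x a : R} : 0 < x -> -1 < a ->
  lebesgue_measure.-integrable `[0, x] (EFin \o (fun s : R => (x - s) `^ a)).
Proof.
move=> x0 a1; have a1' : 0 < a + 1 by rewrite -ltrBlDr sub0r.
have mw : measurable_fun setT (fun s : R => (x - s) `^ a).
  apply: (measurableT_comp (measurable_powR a)) => //.
  exact: measurable_funB.
apply/integrableP; split.
  by apply/measurable_EFinP; exact: measurable_funTS.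
under eq_integral do rewrite /= ger0_norm ?powR_ge0//.
(* The denominator starts at 2 so that [r 0] is already positive. *)
pose r n : R := x - x / n.+2%:R.
have r0x n : 0 < r n < x.
  rewrite /r subr_gt0 ltr_pdivrMr// ltr_pMr// ltr1n/=.
  by rewrite ltrBlDr ltrDl divr_gt0.
have rnd : {homo r : m n / (m <= n)%N >-> m <= n}.
  by move=> p q pq; rewrite lerD2l lerN2 ler_pM2l// lef_pV2 ?posrE// ler_nat.
have bigE : `[0, x[%classic = \bigcup_n `[0, r n]%classic.
  apply/seteqP; split=> s; last first.
    move=> [n _]/=; rewrite !in_itv/= => /andP[-> sr].
    by have /andP[_] := r0x n; exact: le_lt_trans.
  rewrite /= in_itv/= => /andP[s0 sx]; have xs0 : 0 < x - s by rewrite subr_gt0.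
  (* [s <= r n] amounts to [x / (x - s) <= n + 2], which the integer part of the left side
     satisfies. *)
  exists (Num.truncn (x / (x - s))) => //=; rewrite in_itv/= s0/=.
  rewrite lerBrDr -lerBrDl ler_pdivrMr// mulrC -ler_pdivrMr// ltW//.
  by apply: lt_trans (truncnS_gt _) _; rewrite ltr_nat.
rewrite -integral_itv_bndo_bndc; last first.
  by apply/measurable_EFinP; exact: measurable_funTS.
rewrite bigE; pose w (s : R) := ((x - s) `^ a)%:E.
have cvgI : (\int[lebesgue_measure]_(s in `[0%R, r n]) w s)%E @[n --> \oo] -->
    (\int[lebesgue_measure]_(s in \bigcup_n `[0%R, r n]%classic) w s)%E.
  apply: ge0_nondecreasing_set_cvg_integral => //.
  - move=> p q pq; rewrite subsetEset; apply: subset_itvl.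
    by rewrite bnd_simp rnd.
  - by move=> n; apply/measurable_EFinP; exact: measurable_funTS.
  - by move=> n s _; rewrite lee_fin powR_ge0.
(* The bound is the closed form of the truncated integral without its subtracted term, which is
   nonnegative. *)
apply: (@le_lt_trans _ _ (x `^ (a + 1) / (a + 1))%:E); last exact: ltry.
rewrite -(cvg_lim _ cvgI)//; apply: lime_le.
  by apply/cvg_ex; eexists; exact: cvgI.
apply: nearW => n; rewrite integral_powR_reflect// lee_fin.
by rewrite ler_pM2r ?invr_gt0// gerBl powR_ge0.
Qed.

(** * Caputo derivatives of polynomials and the differential operator *)

Lemma derive1n_horner {R : realType} (k : nat) (p : {poly R}) :
  derive1n k (horner p) = horner p^`(k).
Proof. by elim: k => [//|k IH]; rewrite derivnS derivE -IH. Qed.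

Lemma integrable_poly_itv {R : realType} (a b : R) (p : {poly R}) :
  lebesgue_measure.-integrable `[a, b] (EFin \o horner p).
Proof.
apply: continuous_compact_integrable; first exact: segment_compact.
by apply: continuous_subspaceT; exact: continuous_horner.
Qed.

(** An integrable weight times a measurable function that is bounded on the compact segment. *)
Lemma integrable_powR_reflect_poly {R : realType} {x a : R} (p : {poly R}) :
  0 < x -> -1 < a ->
  lebesgue_measure.-integrable `[0, x]
    (EFin \o (fun s : R => (x - s) `^ a * p.[s])).
Proof.
move=> x0 a1.
have -> : EFin \o (fun s : R => (x - s) `^ a * p.[s]) =
    ((EFin \o (fun s => (x - s) `^ a)%R) \* (EFin \o horner p))%E.
  by apply/funext => s; rewrite /= EFinM.
apply: integrableMl => //; first exact: integrable_powR_reflect.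
  apply: measurable_funTS; apply: continuous_measurable_fun.
  exact: continuous_horner.
have cp : {within `[0, x], continuous horner p}.
  by apply: continuous_subspaceT; exact: continuous_horner.
have /compact_bounded[M [Mr Mp]] := continuous_compact cp (@segment_compact _ 0 x).
by exists M; split => // ? ? ? ?; exact: Mp.
Qed.

Lemma caputo_order_le {R : realType} {gamma : R} :
  0 < gamma -> gamma <= `|Num.ceil gamma|%N%:R.
Proof.
move=> g0; rewrite natr_absz gtr0_norm ?ceil_gt0//.
exact: ceil_ge.
Qed.

(** Integrability of the weighted derivatives lets the integral be split at each fixed [x > 0]. This
    gives linearity at a single node, which an almost-everywhere statement cannot. *)
Lemma caputo_poly_linear {R : realType} (gamma x c : R) (p q : {poly R}) :
  0 < gamma -> 0 < x ->
  caputo gamma (horner (c *: p + q)) x =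
  c * caputo gamma (horner p) x + caputo gamma (horner q) x.
Proof.
move=> g0 x0; rewrite /caputo !derive1n_horner derivnD derivnZ.
case: eqP => [_|/eqP gk]; first by rewrite hornerD hornerZ.
(* In the non-integer case [gamma] lies strictly below its ceiling, so the exponent exceeds -1. *)
have a1 : -1 < `|Num.ceil gamma|%N%:R - gamma - 1.
  by rewrite ltrBrDr addNr subr_gt0 lt_neqAle gk caputo_order_le.
set k := `|Num.ceil gamma|%N.
have iw r := integrable_powR_reflect_poly r x0 a1.
under eq_Rintegral do rewrite hornerD hornerZ mulrDr mulrCA.
rewrite RintegralD//=; last first.
  exact: eq_integrable (integrableZl _ c (iw p^`(k))).
by rewrite RintegralZl// mulrDr mulrCA.
Qed.

(* The derivatives of [f] may be junk at the endpoint [0], a null set. *)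
Lemma eq_caputo_poly {R : realType} (gamma x : R) (f : R -> R) (p : {poly R}) :
  0 < gamma -> 0 < x < 1 -> (forall t, 0 < t < 1 -> f t = p.[t]) ->
  caputo gamma f x = caputo gamma (horner p) x.
Proof.
move=> g0 x01 fp; have /andP[x0 x1] := x01.
have eqD k t : 0 < t < 1 -> derive1n k f t = derive1n k (horner p) t.
  elim: k t => [|k IH] t t01; first exact: fp.
  rewrite /derive1n !iterS !derive1E; apply: near_eq_derive.
  have : t \in `]0, 1[ by rewrite in_itv.
  (* Differentiation is local: the agreement holds on an open interval, hence near [t], and passes
     to the next derivative. *)
  move/near_in_itvoo; apply: filterS => s; rewrite in_itv/=; exact: IH.
rewrite /caputo; case: eqP => [_|/eqP gk]; first exact: eqD.
congr (_ * _); set k := `|Num.ceil gamma|%N.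
have a1 : -1 < k%:R - gamma - 1.
  by rewrite ltrBrDr addNr subr_gt0 lt_neqAle gk caputo_order_le.
pose w s := (x - s) `^ (k%:R - gamma - 1).
have ip : lebesgue_measure.-integrable `]0, x]
    (EFin \o (fun s => w s * derive1n k (horner p) s)).
  rewrite derive1n_horner.
  apply: integrableS (integrable_powR_reflect_poly p^`(k) x0 a1) => //.
  exact: subset_itv_oc_cc.
have eqw : {in `]0, x]%classic, (fun s => w s * derive1n k f s) =1
                         (fun s => w s * derive1n k (horner p) s)}.
  move=> s /set_mem; rewrite /= in_itv/= => /andP[s0 sx].
  by rewrite eqD// s0 (le_lt_trans sx).
rewrite -!Rintegral_itv_obnd_cbnd//; first exact: eq_Rintegral.
by apply: eq_integrable ip => // s /eqw/= ->.
Qed.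

Lemma diffop_poly_linear {R : realType} (alpha beta x c : R) (a0 a1 a2 : R -> R)
    (p q : {poly R}) : 0 < alpha -> 0 < beta -> 0 < x ->
  diffop alpha beta a0 a1 a2 (horner (c *: p + q)) x =
  c * diffop alpha beta a0 a1 a2 (horner p) x +
  diffop alpha beta a0 a1 a2 (horner q) x.
Proof.
move=> al be x0; rewrite /diffop !caputo_poly_linear// hornerD hornerZ.
by ring.
Qed.

(** Meant for [f t = (K t).[x]], where the kernel hypothesis controls [K t] only for [t] in
    [[0, 1]]: [f] is known to be a polynomial there and nowhere else. *)
Lemma eq_diffop_poly {R : realType} (alpha beta x : R) (a0 a1 a2 f : R -> R)
    (p : {poly R}) :
  0 < alpha -> 0 < beta -> 0 < x < 1 ->
  (forall t, 0 < t < 1 -> f t = p.[t]) ->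
  diffop alpha beta a0 a1 a2 f x = diffop alpha beta a0 a1 a2 (horner p) x.
Proof.
move=> al be x01 fp.
by rewrite /diffop !(eq_caputo_poly _ _ _ _ _ x01 fp)// fp.
Qed.

(** * Inner product, orthonormal expansion and representation of functionals *)

Lemma ipC {R : realType} (u v : {poly R}) : ip u v = ip v u.
Proof. by apply: eq_Rintegral => x _; rewrite mulrC. Qed.

Lemma ipr0 {R : realType} (u : {poly R}) : ip u 0 = 0.
Proof.
rewrite /ip; under eq_Rintegral do rewrite horner0 mulr0.
by rewrite Rintegral_cst// mul0r.
Qed.

Lemma ip_linear {R : realType} (c : R) (u v w : {poly R}) :
  ip (c *: u + v) w = c * ip u w + ip v w.
Proof.
have ipE (p q : {poly R}) :
    ip p q = \int[lebesgue_measure]_(x in `[0, 1]) (p * q).[x].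
  by apply: eq_Rintegral => x _; rewrite hornerM.
rewrite !ipE mulrDl -scalerAl.
under eq_Rintegral do rewrite hornerD hornerZ.
rewrite RintegralD//=; last 2 first.
- exact: eq_integrable (integrableZl _ c (integrable_poly_itv 0 1 (u * w))).
- exact: integrable_poly_itv.
by rewrite RintegralZl//; exact: integrable_poly_itv.
Qed.

Lemma linear_sum {R : realType} {f : {poly R} -> R} :
  (forall c u v, f (c *: u + v) = c * f u + f v) ->
  forall N (c : nat -> R) (e : nat -> {poly R}),
    f (\sum_(i < N) c i *: e i) = \sum_(i < N) c i * f (e i).
Proof.
move=> fL N c e; elim: N => [|N IH].
  (* This instance reads [f 0 = f 0 + f 0], hence [f 0 = 0]. *)
  rewrite !big_ord0; have := fL 1 0 0; rewrite scaler0 addr0 mul1r => /eqP.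
  by rewrite -subr_eq subrr => /eqP.
by rewrite !big_ord_recr/= addrC fL IH addrC.
Qed.

Lemma spaceW_linear {R : realType} {theta : R} (c : R) {m u v} :
  spaceW theta m u -> spaceW theta m v -> spaceW theta m (c *: u + v).
Proof.
move=> [su u0 ut u1] [sv v0 vt v1]; split; last 3 first.
- by rewrite hornerD hornerZ u0 v0 mulr0 addr0.
- by rewrite hornerD hornerZ ut vt mulr0 addr0.
- by rewrite hornerD hornerZ u1 v1 mulr0 addr0.
apply: leq_trans (size_polyD _ _) _; rewrite geq_max sv andbT.
exact: leq_trans (size_scale_leq _ _) su.
Qed.

Lemma spaceW_sum {R : realType} {theta : R} {m N} (c : nat -> R) {e} :
  (forall j, (j < N)%N -> spaceW theta m (e j)) ->
  spaceW theta m (\sum_(i < N) c i *: e i).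
Proof.
elim: N => [_|N IH eV].
  by rewrite big_ord0; split; rewrite ?size_poly0 ?horner0.
rewrite big_ord_recr/= addrC; apply: spaceW_linear; first exact: eV.
by apply: IH => j jN; apply: eV; exact: ltnW.
Qed.

(** The difference of the two sides lies in the space and is orthogonal to every [e j], so
    completeness makes it zero. Vanishing members of the family contribute nothing to either
    side. *)
Lemma orthonormal_expansion {R : realType} {theta : R} {m N}
    {e : nat -> {poly R}} {z} :
  complete_orthonormal (spaceW theta m) N e -> spaceW theta m z ->
  z = \sum_(i < N) ip z (e i) *: e i.
Proof.
move=> [eV eO eC] zV; apply/esym/eqP; rewrite -subr_eq0; apply/eqP.
rewrite -scaleN1r addrC; apply: eC.
  exact: spaceW_linear zV (spaceW_sum (fun i => ip z (e i)) eV).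
move=> j jN; rewrite ip_linear.
have ipL c u v := ip_linear c u v (e j).
rewrite (linear_sum ipL N (fun i => ip z (e i))).
have [ej0|ej0] := eqVneq (e j) 0.
  by rewrite ej0 ipr0 mulr0 add0r big1// => i _; rewrite ipr0 mulr0.
rewrite (bigD1 (Ordinal jN))//= big1 ?addr0; last first.
  move=> i ij; have [ei0|ei0] := eqVneq (e i) 0.
    by rewrite ei0 ipr0 mul0r.
  by rewrite eO// (negbTE (ij : (i : nat) != j)) mulr0.
by rewrite eO// eqxx mulr1 mulN1r addNr.
Qed.

(** The coefficients of [K x] in the system are the values [(e i).[x]], so [phi] agrees on [[0, 1]]
    with the sum of the [f (e i) *: e i]. Pairing this with [z] gives [f] applied to the expansion
    of [z]. The finite expansion lets [f] pass through the kernel by algebra alone. *)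
Lemma riesz_kernel {R : realType} {theta : R} {m N} {e : nat -> {poly R}}
    {K : R -> {poly R}} {f : {poly R} -> R} {phi z : {poly R}} :
  complete_orthonormal (spaceW theta m) N e ->
  reproducing_kernel (spaceW theta m) K ->
  (forall c u v, f (c *: u + v) = c * f u + f v) ->
  (forall x, 0 <= x <= 1 -> phi.[x] = f (K x)) ->
  spaceW theta m z -> ip z phi = f z.
Proof.
move=> eCO hK fL phiE zV.
have -> : ip z phi = ip z (\sum_(i < N) f (e i) *: e i).
  (* Equality of values on [[0, 1]] suffices, since the inner product sees nothing else. *)
  apply: eq_Rintegral => x /set_mem; rewrite /= in_itv/= => x01.
  have [KV Kx] := hK x x01; congr (_ * _).
  rewrite phiE// (orthonormal_expansion eCO KV).
  rewrite (linear_sum fL N (fun i => ip (K x) (e i))) horner_sum.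
  apply: eq_bigr => i _; rewrite hornerZ mulrC ipC Kx//.
  by have [eV _ _] := eCO; exact: eV.
have ipL c u v := ip_linear c u v z.
rewrite ipC (linear_sum ipL N (fun i => f (e i))).
rewrite [in RHS](orthonormal_expansion eCO zV).
rewrite (linear_sum fL N (fun i => ip z (e i))).
by apply: eq_bigr => i _; rewrite mulrC ipC.
Qed.

Theorem theorem3p7 (R : realType) (theta alpha beta : R)
  (a0 a1 a2 : R -> R) (g : R -> R -> R -> R)
  (m : nat) (xi : nat -> R) (K : R -> {poly R})
  (psi psibar : nat -> {poly R}) (b : nat -> nat -> R)
  (P : {poly R} -> {poly R}) (n : nat) (y z : nat -> {poly R})
  (htheta : 0 < theta < 1) (halpha : 1 < alpha <= 2) (hbeta : 0 < beta <= 1)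
  (ha0 : C2_open01 a0) (ha1 : C2_open01 a1) (ha2 : C2_open01 a2)
  (hg : {within [set p : R * R * R | 0 < p.1.1 < 1],
          continuous (fun p : R * R * R => g p.1.1 p.1.2 p.2)})
  (hgL2 : forall v : {poly R}, spaceW theta m v ->
            L2mem (fun x => g x v.[x] v^`().[x]))
  (hL : bounded_linear_L2 (spaceW theta m)
          (fun v => diffop alpha beta a0 a1 a2 (horner v)))
  (hm : (2 <= m)%N)
  (hxi01 : forall j, (j < m.-1)%N -> 0 < xi j < 1)
  (hxi_distinct : forall i j, (i < m.-1)%N -> (j < m.-1)%N ->
                    xi i = xi j -> i = j)
  (hK : reproducing_kernel (spaceW theta m) K)
  (hpsi : forall j, (j < m.-1)%N ->
            spaceW theta m (psi j) /\
            forall x : R, 0 <= x <= 1 ->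
              (psi j).[x] =
              diffop alpha beta a0 a1 a2 (fun t => (K t).[x]) (xi j))
  (hgs : gram_schmidt m.-1 psi psibar b)
  (hcomplete : complete_orthonormal (spaceW theta m) m.-1 psibar)
  (hP : orthogonal_projection (spaceW theta m) (span_of m.-1 psibar) P)
  (hn : (1 <= n)%N)
  (hscheme : scheme (spaceW theta m) (diffop alpha beta a0 a1 a2) g P n y z) :
  y n = \sum_(j < m.-1) \sum_(k < j.+1)
          (b j k * g (xi k) (z n.-1).[xi k] (z n.-1)^`().[xi k]) *: psibar j.
Proof.
have [/andP[al _] /andP[be _]] := (halpha, hbeta).
have al0 : 0 < alpha by exact: lt_trans al.
have [_ /(_ n)[]] := hscheme; first by rewrite hn leqnn.
move=> ynV Lyn _.
rewrite [LHS](orthonormal_expansion hcomplete ynV).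
apply: eq_bigr => j _; rewrite -scaler_suml; congr (_ *: _).
(* The outer factor [psibar j] has been stripped, so only the one inside the Fourier coefficient is
   expanded in the [psi k]. *)
have [_ ->] := hgs _ (ltn_ord j).
have ipL c u v := ip_linear c u v (y n).
rewrite ipC (linear_sum ipL).
apply: eq_bigr => k _; congr (_ * _).
have kN : (k < m.-1)%N by exact: leq_trans (ltn_ord k) (ltn_ord j).
have xik := hxi01 _ kN; have /andP[xik0 _] := xik.
rewrite -Lyn// ipC.
(* The node is interior, so the scheme has turned the value of [g] into [L] applied to [y n] at
   [xi k]. What remains is that [psi k] represents this evaluation functional. *)
apply: (riesz_kernel (f := fun v => diffop alpha beta a0 a1 a2 (horner v) (xi k))
  hcomplete hK) => //.
- by move=> c u v; exact: diffop_poly_linear.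
- move=> x x01; have [_ ->//] := hpsi _ kN.
  (* Kernel symmetry: [(K t).[x]] and [(K x).[t]] both equal the inner product of [K x] and [K t],
     so [L] acting on the parameter of the kernel is [L] acting on the polynomial [K x]. *)
  apply: eq_diffop_poly => // t /andP[/ltW t0 /ltW t1].
  have t01 : 0 <= t <= 1 by rewrite t0.
  have [KtV Kt] := hK t t01; have [KxV Kx] := hK x x01.
  by rewrite -Kx// ipC Kt.
Qed.
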